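(* Let $(U,\mathcal{F})$ be a convex geometry with closure operator $\phi$. A pair $(U,\Sigma)$, where $\Sigma$ is a collection of valid implications of $(U,\mathcal{F})$, is a left-optimum implicational base of $(U,\mathcal{F})$ if and only if $\Sigma$ is obtained by choosing, for each essential set $C$, exactly one implication of the form $\mathrm{ex}(C)\to T$ where $T$ is a hitting set of the quasi-closed hypergraph $\mathcal{Q}(C)$. Likewise, $(U,\Sigma)$ is an optimum implicational base of $(U,\mathcal{F})$ if and only if $\Sigma$ is obtained by choosing, for each essential set $C$, exactly one implication of the form $\mathrm{ex}(C)\to T$ where $T$ is a minimum hitting set of $\mathcal{Q}(C)$.
   Context: All sets are finite. A closure system is a pair $(U,\mathcal{F})$ with $\mathcal{F}\subseteq 2^U$, $U\in\mathcal{F}$, closed under intersection; its closure operator is $\phi(A)=\bigcap\{C\in\mathcal{F}: A\subseteq C\}$, and the members of $\mathcal{F}$ are the closed sets. $(U,\mathcal{F})$ is a convex geometry if $\emptyset\in\mathcal{F}$ and for every closed $C\subsetneq U$ there is $x\notin C$ with $C\cup\{x\}$ closed. For $A\subseteq U$, $\mathrm{ex}(A)=\{x\in A: x\notin\phi(A\setminus\{x\})\}$ (extreme points). A set $Q\subseteq U$ is quasi-closed if $Q$ is not closed and for every $A\subseteq Q$, $\phi(A)\subsetneq\phi(Q)$ implies $\phi(A)\subseteq Q$. A closed set $C$ is essential if $C=\phi(Q)$ for some quasi-closed $Q$; the quasi-closed sets of $C$ are the quasi-closed $Q$ with $\phi(Q)=C$. The quasi-closed hypergraph $\mathcal{Q}(C)$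 of an essential set $C$ has vertex set $C$ and edges $C\setminus Q$ for $Q$ ranging over the inclusion-wise maximal quasi-closed sets of $C$. A hitting set of a hypergraph is a vertex set meeting every edge; minimum means of minimum cardinality. An implication over $U$ is $A\to B$ with $A,B\subseteq U$; a set $X$ satisfies it if $A\subseteq X$ implies $B\subseteq X$. For a collection $\Sigma$ of implications, $(U,\Sigma)$ is an implicational base of $(U,\mathcal{F})$ if $\mathcal{F}$ is exactly the family of subsets of $U$ satisfying all implications of $\Sigma$. An implication $A\to B$ is valid in $(U,\mathcal{F})$ if $B\subseteq\phi(A)$. The left-size of $\Sigma$ is $\sum_{A\to B\in\Sigma}|A|$, the right-size is $\sum|B|$, the total size is their sum. An implicational base of $(U,\mathcal{F})$ is left-optimum (resp. optimum) if it minimizes left-size (resp. total size) among all implicational bases of $(U,\mathcal{F})$.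
   Formalization: The collection Σ is additionally assumed not to contain the vacuous implication ∅→∅; it has size 0, so adding it to any (left-)optimum base keeps optimality but breaks the stated form, making the literal ''only if'' directions false. *)

(* Defs.v *)
From mathcomp Require Import all_boot.
Set Implicit Arguments.
Unset Strict Implicit.
Unset Printing Implicit Defensive.

(* The ground set is the whole finite type U. *)
Section ConvexGeometries.
Variable U : finType.
Implicit Types (F E : {set {set U}}) (A C Q T V X : {set U}).

(* Over a finite ground set, closure under binary intersections together with
   U being closed amounts to closure under arbitrary intersections. *)
Definition closure_system F : Prop :=
  [set: U] \in F /\ {in F &, forall A C, A :&: C \in F}.

Definition closure F A : {set U} := \bigcap_(C in F | A \subset C) C.

Definition convex_geometry F : Prop :=
  [/\ closure_system F, set0 \in F &
      forall C, C \in F -> C \proper [set: U] ->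
        exists2 x, x \notin C & x |: C \in F].

Definition extreme F A : {set U} := [set x in A | x \notin closure F (A :\ x)].

Definition quasi_closed F Q : bool :=
  (Q \notin F) &&
  [forall (A : {set U} | A \subset Q),
     (closure F A \proper closure F Q) ==> (closure F A \subset Q)].

Definition quasi_closed_of F C Q : bool :=
  quasi_closed F Q && (closure F Q == C).

Definition essential F : {set {set U}} :=
  [set C in F | [exists Q, quasi_closed_of F C Q]].

(* The quasi-closed hypergraph of C is given by the vertex set C together with
   these edges; the vertex set enters as the first argument of hitting_set. *)
Definition qc_edges F C : {set {set U}} :=
  [set C :\: Q | Q in [set Q' | maxset (quasi_closed_of F C) Q']].

Definition hitting_set V E T : bool :=
  (T \subset V) && [forall (e | e \in E), T :&: e != set0].

Definition minimum_hitting_set V E T : Prop :=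
  hitting_set V E T /\ forall T', hitting_set V E T' -> #|T| <= #|T'|.

(* The pair (A, B) is the implication A -> B. *)
Definition implication : Type := ({set U} * {set U})%type.
Implicit Types (i : implication) (S : {set {set U} * {set U}}).

Definition satisfies X i : bool := (i.1 \subset X) ==> (i.2 \subset X).

Definition valid F i : bool := i.2 \subset closure F i.1.

Definition implicational_base F S : Prop :=
  F = [set X | [forall (i | i \in S), satisfies X i]].

Definition left_size S : nat := \sum_(i in S) #|i.1|.
Definition right_size S : nat := \sum_(i in S) #|i.2|.
Definition total_size S : nat := left_size S + right_size S.

Definition left_optimum F S : Prop :=
  implicational_base F S /\
  forall S', implicational_base F S' -> left_size S <= left_size S'.

Definition optimum F S : Prop :=
  implicational_base F S /\
  forall S', implicational_base F S' -> total_size S <= total_size S'.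

(* S consists of one implication ex(C) -> T C per essential set C, where the
   choice T C satisfies P C. *)
Definition chosen_from F (P : {set U} -> {set U} -> Prop) S : Prop :=
  exists2 T : {set U} -> {set U},
    forall C, C \in essential F -> P C (T C) &
    S = [set (extreme F C, T C) | C in essential F].

End ConvexGeometries.

(* Main.v *)
(** Every implicational base must, for each quasi-closed set [Q] of an essential
    set [C], contain an implication [A -> B] with [A] inside [Q], [B] not inside
    [Q] and [closure A = C].  Hence each essential set [C] owns a nonempty class
    of implications; their premises contain [ex(C)], and the union of their
    conclusions hits the hypergraph of [C].  This bounds left-size and
    right-size from below, class by class.  In a convex geometry [ex(C)] itself
    spans [C], so the implications [ex(C) -> T] attain both bounds, and they
    form a base: a non-closed model would contain a quasi-closed set
    missed by [T]. *)

Require Import Defs.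
Require Import Defs.
From mathcomp Require Import all_boot.
(* [closure] must denote the operator of Defs, not the one of fingraph. *)
Import Defs.

(** * Closure, extreme points and quasi-closed sets *)

Section ClosureSystem.
Context {U : finType} {F : {set {set U}}}.
Implicit Types (A B C Q T X : {set U}) (S : {set {set U} * {set U}}).

Lemma sub_closure A : A \subset closure F A.
Proof. by apply/bigcapsP => C /andP[]. Qed.

Lemma closure_min {A C} : C \in F -> A \subset C -> closure F A \subset C.
Proof. by move=> FC sAC; apply: bigcap_inf; rewrite FC. Qed.

Lemma closureS {A B} : A \subset B -> closure F A \subset closure F B.
Proof.
move=> sAB; apply/bigcapsP => C /andP[FC sBC].
by apply: closure_min => //; apply: subset_trans sBC.
Qed.

Lemma closure_id {C} : C \in F -> closure F C = C.
Proof.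
by move=> FC; apply/eqP; rewrite eqEsubset sub_closure closure_min.
Qed.

(** A point [x] of [C] outside [A] lies in the closure of [C :\ x], since [C :\ x] contains [A]; so
    [x] is not extreme. *)
Lemma extreme_subset {A C} : closure F A = C -> extreme F C \subset A.
Proof.
move=> clA; have sAC : A \subset C by rewrite -clA sub_closure.
apply/subsetP => x; rewrite inE => /andP[Cx]; apply: contraNT => Ax.
have /closureS : A \subset C :\ x by rewrite subsetD1 sAC.
by rewrite clA => /subsetP; apply.
Qed.

Lemma closure_extreme_subset {C} : C \in F -> closure F (extreme F C) \subset C.
Proof.
by move=> FC; apply: closure_min => //; apply/subsetP => x; rewrite inE => /andP[].
Qed.

Lemma quasi_closed_of_proper {C Q} :
  C \in F -> quasi_closed_of F C Q -> Q \proper C.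
Proof.
move=> FC /andP[/andP[FQ _] /eqP clQ].
rewrite properEneq -{2}clQ sub_closure andbT.
by apply: contraNneq FQ => ->.
Qed.

Lemma hitting_setP {C T} :
  reflect (T \subset C /\
           forall Q, maxset (quasi_closed_of F C) Q -> ~~ (T \subset Q))
          (hitting_set C (qc_edges F C) T).
Proof.
have hitE Q : T \subset C -> (T :&: (C :\: Q) != set0) = ~~ (T \subset Q).
  by move=> /setIidPl sTC; rewrite setIDA sTC setD_eq0.
apply: (iffP andP) => -[sTC hitT]; split=> //.
  move=> Q maxQ; rewrite -hitE //; apply: (implyP (forallP hitT _)).
  by apply: imset_f; rewrite inE.
apply/forall_inP => _ /imsetP[Q + ->]; rewrite inE => maxQ.
by rewrite hitE ?hitT.
Qed.

Lemma hitting_set_self {C} : C \in F -> hitting_set C (qc_edges F C) C.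
Proof.
move=> FC; apply/hitting_setP; split=> // Q /maxsetp qcQ.
by have /properP[_ [x Cx]] := quasi_closed_of_proper FC qcQ;
  apply: contra => /subsetP->.
Qed.

(** * Implicational bases of a closure system *)

Hypothesis sysF : closure_system F.

Lemma closure_closed A : closure F A \in F.
Proof. by have [FT FI] := sysF; apply: (big_ind (fun C => C \in F)) => // C /andP[]. Qed.

Lemma base_mem {S} : implicational_base F S ->
  forall X, (X \in F) = [forall (i | i \in S), satisfies X i].
Proof. by move=> baseS X; rewrite {1}baseS inE. Qed.

Lemma base_valid {S} i : implicational_base F S -> i \in S -> valid F i.
Proof.
move=> baseS Si; have := closure_closed i.1.
by rewrite (base_mem baseS) => /forall_inP/(_ i Si)/implyP; apply; apply: sub_closure.
Qed.

(** Some implication of the base fails at [Q]. Were the closure of its premise properly inside [C],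
    quasi-closedness would put that closure, and with it the conclusion, inside [Q]. *)
Lemma base_quasi_closed {S C Q} :
  implicational_base F S -> quasi_closed_of F C Q ->
  exists i, [/\ i \in S, closure F i.1 = C, i.1 \subset Q & ~~ (i.2 \subset Q)].
Proof.
move=> baseS /andP[/andP[FQ qcQ] /eqP clQ].
move: (FQ); rewrite (base_mem baseS) => /forall_inPn[i Si].
rewrite negb_imply => /andP[sAQ nsBQ]; exists i; split=> //.
apply/eqP; move/forall_inP/(_ _ sAQ): qcQ.
rewrite -clQ; apply: contraTT => neq.
rewrite negb_imply properEneq neq closureS //=.
by apply: contra nsBQ; apply: subset_trans; apply: (base_valid i baseS Si).
Qed.

(* The set [A], of least cardinality with [closure A] outside [X], spans an
   essential set, and [X] cuts it in a quasi-closed set. *)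
Lemma quasi_closed_trace X : X \notin F ->
  exists2 C, C \in essential F & quasi_closed_of F C (X :&: C).
Proof.
move=> FX; pose P A := (A \subset X) && ~~ (closure F A \subset X).
have PX : P X.
  rewrite /P subxx; apply: contra FX => sclX.
  by rewrite (_ : X = closure F X) ?closure_closed //; apply/eqP;
     rewrite eqEsubset sub_closure.
(* What is minimized is the size of the closure, so a set whose closure is properly inside [C]
   cannot satisfy [P]. *)
pose m A := #|closure F A|.
case: (arg_minnP m PX) => A /andP[sAX nsAX] minA.
set C := closure F A in nsAX.
have FC : C \in F by apply: closure_closed.
have clQ : closure F (X :&: C) = C.
  apply/eqP; rewrite eqEsubset closure_min ?subsetIr //=.
  by apply: closureS; rewrite subsetI sAX sub_closure.
suff qcQ : quasi_closed_of F C (X :&: C).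
  by exists C => //; rewrite inE FC; apply/existsP; exists (X :&: C).
apply/andP; split; last by rewrite clQ.
apply/andP; split.
  by apply: contra nsAX => /closure_id; rewrite clQ => ->; apply: subsetIl.
apply/forall_inP => B; rewrite subsetI => /andP[sBX sBC].
rewrite clQ; apply/implyP => ltBC; rewrite subsetI (proper_sub ltBC) andbT.
apply/negPn/negP => nsBX; have := minA B.
by rewrite /P sBX nsBX leqNgt => /(_ isT); rewrite (proper_card ltBC).
Qed.

End ClosureSystem.

(** * Convex geometries and bases built from extreme points *)

Section ConvexGeometry.
Context {U : finType} {F : {set {set U}}}.
Implicit Types (A B C Q T X : {set U}) (S : {set {set U} * {set U}}).
Implicit Types (t : {set U} -> {set U}) (f : {set U} * {set U} -> nat).
Hypothesis convF : convex_geometry F.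

Let sysF : closure_system F. Proof. by case: convF. Qed.

Lemma closure_set0 : closure F set0 = set0.
Proof. by have [_ F0 _] := convF; apply: closure_id. Qed.

(* If [ex(C)] spanned less than [C], a maximal closed proper subset [D] of [C]
   containing it would miss exactly one point of [C], which would then be
   extreme. *)
Lemma closure_extreme C : C \in F -> closure F (extreme F C) = C.
Proof.
move=> FC; have [[FT FI] _ ext] := convF.
apply/eqP; rewrite eqEsubset closure_extreme_subset //=.
apply: contraT => ns.
pose P D := [&& D \in F, closure F (extreme F C) \subset D & D \proper C].
have P0 : P (closure F (extreme F C)).
  by rewrite /P closure_closed // subxx properE ns closure_extreme_subset.
have [D maxD _] := maxset_exists P0.
have /and3P[FD sexD ltDC] := maxsetp maxD.
(* The extension axiom need not add a point of [C]. Applied to a maximal closed [K] with trace [D]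
   on [C], it must. *)
pose R K := (K \in F) && (K :&: C == D).
have R0 : R D by rewrite /R FD; apply/eqP/setIidPl/proper_sub.
have [K maxK _] := maxset_exists R0.
have /andP[FK /eqP KC] := maxsetp maxK.
have neKT : K \proper [set: U].
  rewrite properT; apply: contraTneq ltDC => KT.
  by rewrite -KC KT setTI properxx.
have [x Kx FxK] := ext K FK neKT.
have Cx : x \in C.
  apply: contraNT Kx => Cx; rewrite -(maxsetsup maxK _ (subsetU1 x K)) ?setU11 //.
  have x0 : [set x] :&: C = set0 by apply/disjoint_setI0; rewrite disjoints1.
  by rewrite /R FxK setIUl KC x0 set0U /=.
have xD : (x |: K) :&: C = x |: D.
  by rewrite setIUl KC (setIidPl _) // sub1set.
have Dx : x \notin D by apply: contra Kx; rewrite -KC => /setIP[].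
have FxD : x |: D \in F by rewrite -xD FI.
have CE : x |: D = C.
  apply/eqP; apply: contraT => neq.
  have /(maxsetsup maxD)/(_ (subsetU1 x D)) DE : P (x |: D).
    rewrite /P FxD (subset_trans sexD (subsetU1 _ _)) properEneq neq.
    by rewrite subUset sub1set Cx proper_sub.
  by rewrite -DE setU11 in Dx.
have : x \in extreme F C.
  by rewrite inE Cx -CE setU1K // closure_id.
by move/(subsetP (sub_closure _))/(subsetP sexD); rewrite (negPf Dx).
Qed.

Lemma essential_closed {C} : C \in essential F -> C \in F.
Proof. by rewrite inE => /andP[]. Qed.

(** The closure recovers [C] from [extreme F C]. Hence distinct essential sets give distinct
    implications, and sums over [choice_base] can be reindexed by essential sets. *)
Lemma extreme_inj : {in essential F &, injective (extreme F)}.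
Proof.
move=> C D /essential_closed FC /essential_closed FD eqE.
by rewrite -(closure_extreme _ FC) eqE closure_extreme.
Qed.

Definition choice_base t : {set {set U} * {set U}} :=
  [set (extreme F C, t C) | C in essential F].

Lemma sum_choice_base t f :
  \sum_(i in choice_base t) f i =
  \sum_(C in essential F) f (extreme F C, t C).
Proof. by rewrite big_imset //= => C D eC eD [/extreme_inj->]. Qed.

Lemma choice_base_is_base t :
  {in essential F, forall C, hitting_set C (qc_edges F C) (t C)} ->
  implicational_base F (choice_base t).
Proof.
move=> hit_t; apply/setP => X; rewrite inE; apply/idP/forall_inP.
  move=> FX _ /imsetP[C eC ->]; apply/implyP => /= sexX.
  have /hitting_setP[stC _] := hit_t C eC.
  apply: subset_trans stC _; rewrite -(closure_extreme _ (essential_closed eC)).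
  exact: closure_min.
move=> satX; apply: contraT => FX.
have [C eC qcQ] := quasi_closed_trace sysF _ FX.
(* [X] contains [extreme F C], hence [t C], so [t C] lies in [X :&: C] and thus in [Q]; a hitting
   set cannot. *)
have [Q maxQ sXQ] := maxset_exists qcQ.
have /hitting_setP[stC /(_ Q maxQ)] := hit_t C eC.
case/negP; apply: subset_trans sXQ; rewrite subsetI stC andbT.
have /satX/implyP : (extreme F C, t C) \in choice_base t by apply: imset_f.
apply; apply: subset_trans (subsetIl X C).
by apply: extreme_subset; case/andP: qcQ => _ /eqP.
Qed.

(** The last sum is the surplus over the class-by-class bounds: it collects the premises that span
    no essential set. *)
Lemma sum_by_closure S f :
  \sum_(i in S) f i =
  \sum_(C in essential F) \sum_(i in S | closure F i.1 == C) f i +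
  \sum_(i in S | closure F i.1 \notin essential F) f i.
Proof.
rewrite (bigID (fun i => closure F i.1 \in essential F)) /=; congr (_ + _).
rewrite (partition_big (fun i => closure F i.1) (mem (essential F))) /=.
  apply: eq_bigr => C eC; apply: eq_bigl => i.
  by rewrite -andbA; case: eqP => [->|_]; rewrite ?eC ?andbT ?andbF.
by move=> i /andP[].
Qed.

Definition least_hitting_set C : {set U} :=
  [arg min_(T < C | hitting_set C (qc_edges F C) T) #|T|].

Lemma least_hitting_setP C : C \in essential F ->
  minimum_hitting_set C (qc_edges F C) (least_hitting_set C).
Proof.
move=> /essential_closed/hitting_set_self hitC; rewrite /least_hitting_set.
by case: arg_minnP.
Qed.

(** * Lower bounds on both sizes, and the equality case for left-size *)

Section Bounds.
Context {S : {set {set U} * {set U}}}.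
Hypothesis baseS : implicational_base F S.

Lemma essential_implication {C} : C \in essential F ->
  exists2 i, i \in S & closure F i.1 = C.
Proof.
rewrite inE => /andP[_ /existsP[Q qcQ]].
by have [i [Si clA _ _]] := base_quasi_closed sysF baseS qcQ; exists i.
Qed.

Lemma card_extreme_le C : C \in essential F ->
  #|extreme F C| <= \sum_(i in S | closure F i.1 == C) #|i.1|.
Proof.
move=> /essential_implication[i Si clA].
rewrite (bigD1 i) /=; last by rewrite Si clA eqxx.
by apply: leq_trans (leq_addr _ _); apply/subset_leq_card/extreme_subset.
Qed.

Lemma hitting_set_conclusions C :
  hitting_set C (qc_edges F C) (\bigcup_(i in S | closure F i.1 == C) i.2).
Proof.
apply/hitting_setP; split.
  by apply/bigcupsP => i /andP[Si /eqP <-]; apply: base_valid baseS Si.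
move=> Q /maxsetp qcQ.
have [i [Si clA _]] := base_quasi_closed sysF baseS qcQ.
by apply: contra; apply: subset_trans; apply: bigcup_sup; rewrite Si clA /=.
Qed.

Lemma card_least_hitting_set_le C : C \in essential F ->
  #|least_hitting_set C| <= \sum_(i in S | closure F i.1 == C) #|i.2|.
Proof.
move=> /least_hitting_setP[_ /(_ _ (hitting_set_conclusions C)) leT].
apply: leq_trans leT _.
by apply: (big_rec2 (fun A n => #|A| <= n)); rewrite ?cards0 // => i n A _ leAn;
  apply: leq_trans (leq_card_setU _ _) _; rewrite leq_add2l.
Qed.

Lemma left_size_ge : \sum_(C in essential F) #|extreme F C| <= left_size S.
Proof.
rewrite /left_size sum_by_closure.
by apply: leq_trans (leq_addr _ _); apply: leq_sum => C; apply: card_extreme_le.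
Qed.

Lemma right_size_ge :
  \sum_(C in essential F) #|least_hitting_set C| <= right_size S.
Proof.
rewrite /right_size sum_by_closure.
apply: leq_trans (leq_addr _ _); apply: leq_sum => C.
exact: card_least_hitting_set_le.
Qed.

(** Equality of the sums forces equality in every class and a zero surplus. As all premises are
    nonempty, each class is a single implication and no implication lies outside the classes. *)
Lemma left_tight_chosen : (set0, set0) \notin S ->
  left_size S <= \sum_(C in essential F) #|extreme F C| ->
  chosen_from F (fun C T => hitting_set C (qc_edges F C) T) S.
Proof.
move=> S00 leS.
(* Since the empty set is closed, [(set0, set0)] is the only valid implication with an empty
   premise. *)
have lhs_gt0 i : i \in S -> 0 < #|i.1|.
  case: i => A B SAB; rewrite lt0n cards_eq0; apply: contraNneq S00 => /= A0.
  have := base_valid sysF _ baseS SAB; rewrite /valid /= A0 closure_set0 subset0.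
  by move=> /eqP B0; rewrite -{1}A0 -B0.
move: leS; rewrite /left_size sum_by_closure => leS.
have eq_class C : C \in essential F ->
    \sum_(i in S | closure F i.1 == C) #|i.1| = #|extreme F C|.
  have := leqif_sum (fun C eC => leqif_eq (card_extreme_le C eC)).
  move=> leif eC; apply/esym/eqP; move: C eC; apply/forall_inP.
  rewrite -(geq_leqif leif).
  exact: leq_trans (leq_addr _ _) leS.
have ess i : i \in S -> closure F i.1 \in essential F.
  move=> Si; apply: contraT => neC; move: leS.
  rewrite (eq_bigr _ eq_class) -[leqRHS]addn0 leq_add2l leqn0 sum_nat_eq0.
  by move=> /forallP/(_ i); rewrite Si neC /= -leqn0 leqNgt lhs_gt0.
have class1 i C : i \in S -> C \in essential F -> closure F i.1 = C ->
    i.1 = extreme F C /\ forall j, j \in S -> closure F j.1 = C -> j = i.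
  move=> Si eC clA; have := eq_class C eC.
  rewrite (bigD1 i) /=; last by rewrite Si clA eqxx.
  have sexA := extreme_subset clA => eqS.
  (* The premise of [i] contains [extreme F C], so it alone exhausts the total of its class. *)
  have sum0 : \sum_(j in S | (closure F j.1 == C) && (j != i)) #|j.1| = 0.
    apply/eqP; rewrite -leqn0 -(leq_add2l #|i.1|) addn0.
    under eq_bigl do rewrite andbA.
    by rewrite eqS subset_leq_card.
  split.
    apply/esym/eqP; rewrite eqEcard sexA -eqS; under eq_bigl do rewrite -andbA.
    by rewrite sum0 addn0 /=.
  move=> j Sj clj; apply/eqP; apply: contraT => neq.
  move/eqP: sum0; rewrite sum_nat_eq0 => /forallP/(_ j).
  by rewrite Sj clj eqxx neq /= -leqn0 leqNgt lhs_gt0.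
exists (fun C => \bigcup_(i in S | closure F i.1 == C) i.2) => [C _|].
  exact: hitting_set_conclusions.
have imp i C : i \in S -> C \in essential F -> closure F i.1 = C ->
    i = (extreme F C, \bigcup_(i in S | closure F i.1 == C) i.2).
  move=> Si eC clA; have [exA uniq_i] := class1 i C Si eC clA.
  rewrite (big_pred1 i) => [|j]; first by rewrite -exA; case: (i).
  by apply/andP/eqP => [[Sj /eqP/(uniq_i j Sj)] //|->]; rewrite clA.
apply/setP => i; apply/idP/imsetP => [Si|[C eC ->]].
  by exists (closure F i.1); [apply: ess | apply: imp; rewrite ?ess].
by have [j Sj clA] := essential_implication eC; rewrite -(imp j).
Qed.

End Bounds.

(** * The two characterizations *)

Lemma least_base : implicational_base F (choice_base least_hitting_set).
Proof. by apply: choice_base_is_base => C /least_hitting_setP[]. Qed.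

Lemma left_optimum_chosen S : (set0, set0) \notin S ->
  left_optimum F S <->
    chosen_from F (fun C T => hitting_set C (qc_edges F C) T) S.
Proof.
move=> S00; split=> [[baseS /(_ _ least_base)]|[t hit_t ->]].
  by rewrite [left_size (choice_base _)]sum_choice_base; apply: left_tight_chosen.
split=> [|S' baseS']; first exact: choice_base_is_base.
rewrite [left_size _](sum_choice_base t (fun i => #|i.1|)).
exact: left_size_ge.
Qed.

Lemma optimum_chosen S : (set0, set0) \notin S ->
  optimum F S <->
    chosen_from F (fun C T => minimum_hitting_set C (qc_edges F C) T) S.
Proof.
move=> S00; split=> [[baseS /(_ _ least_base)]|[t min_t ->]].
  rewrite {2}/total_size [left_size (choice_base _)]sum_choice_base.
  rewrite [right_size (choice_base _)]sum_choice_base /= => leS.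
  (* Right-size is at least its bound, so a total not exceeding the sum of both bounds keeps
     left-size within its own. *)
  have leL : left_size S <= \sum_(C in essential F) #|extreme F C|.
    rewrite -(leq_add2r (\sum_(C in essential F) #|least_hitting_set C|)).
    by apply: leq_trans leS; rewrite leq_add2l right_size_ge.
  have [t hit_t defS] := left_tight_chosen baseS S00 leL; exists t => //.
  (* By [defS] the left-size equals its bound, so right-size is within its bound too; comparing term
     by term makes each [t C] minimum. *)
  have leR : \sum_(C in essential F) #|t C|
             <= \sum_(C in essential F) #|least_hitting_set C|.
    move: leS; rewrite /total_size {1 2}defS.
    rewrite [left_size _](sum_choice_base t (fun i => #|i.1|)).
    by rewrite [right_size _](sum_choice_base t (fun i => #|i.2|)) leq_add2l.
  have min_le C : C \in essential F -> #|least_hitting_set C| <= #|t C|.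
    by move=> eC; apply: (least_hitting_setP C eC).2; apply: hit_t.
  have leif := leqif_sum (fun C eC => leqif_eq (min_le C eC)).
  move: leR; rewrite (geq_leqif leif) => /forall_inP eq_t C eC.
  split=> [|T' hitT']; first exact: hit_t.
  rewrite -(eqP (eq_t C eC)); exact: (least_hitting_setP C eC).2.
split=> [|S' baseS']; first by apply: choice_base_is_base => C /min_t[].
apply: leq_add.
  rewrite [left_size _](sum_choice_base t (fun i => #|i.1|)).
  exact: left_size_ge.
rewrite [right_size _](sum_choice_base t (fun i => #|i.2|)) /=.
apply: leq_trans (right_size_ge baseS'); apply: leq_sum => C eC.
by apply: (min_t C eC).2; case: (least_hitting_setP C eC).
Qed.

End ConvexGeometry.

Theorem theorem1 (U : finType) (F : {set {set U}})
    (S : {set {set U} * {set U}})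
    (convF : convex_geometry F)
    (validS : forall i, i \in S -> valid F i)
    (no_empty_implication : (set0, set0) \notin S) :
  (left_optimum F S <->
     chosen_from F (fun C T => hitting_set C (qc_edges F C) T) S) /\
  (optimum F S <->
     chosen_from F (fun C T => minimum_hitting_set C (qc_edges F C) T) S).
Proof.
by split; [apply: left_optimum_chosen | apply: optimum_chosen].
Qed.
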